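(* Let $G$ be a finite simple graph with $\operatorname{mad}(G) < 25/4$. Then $\tau(G) \leq 2\nu(G)$.
   Context: $\nu(G)$ is the maximum number of pairwise edge-disjoint triangles in $G$. $\tau(G)$ is the minimum size of an edge set $Y \subseteq E(G)$ such that $G - Y$ is triangle-free. The maximum average degree is $\operatorname{mad}(G) = \max\{2|E(H)|/|V(H)| : H \subseteq G,\ V(H)\neq\emptyset\}$. *)

(* Defs.v *)
From mathcomp Require Import all_boot all_order all_algebra.
Set Implicit Arguments. Unset Strict Implicit. Unset Printing Implicit Defensive.
Import Order.TTheory GRing.Theory Num.Theory.

Section Graph.
Variables (T : finType) (e : rel T).

Definition simple_graph := symmetric e /\ irreflexive e.

Definition edges : {set {set T}} :=
  [set E : {set T} | [exists x, exists y, (E == [set x; y]) && e x y]].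

Definition edges_in (S : {set T}) : {set {set T}} :=
  [set E in edges | E \subset S].

Definition triangles : {set {set T}} :=
  [set X : {set T} | (#|X| == 3) && [forall x in X, forall y in X, (x != y) ==> e x y]].

Definition tri_edges (X : {set T}) : {set {set T}} := [set E in edges | E \subset X].

Definition tri_packing (P : {set {set T}}) : bool :=
  (P \subset triangles) &&
  [forall X in P, forall Y in P, (X != Y) ==> [disjoint tri_edges X & tri_edges Y]].

Definition nu : nat := \max_(P : {set {set T}} | tri_packing P) #|P|.

Definition tri_cover (Y : {set {set T}}) : bool :=
  (Y \subset edges) && [forall X in triangles, ~~ [disjoint tri_edges X & Y]].

(* tau(G): minimum size of a triangle transversal (edges itself is one) *)
Definition tau : nat := \big[minn/#|edges|]_(Y : {set {set T}} | tri_cover Y) #|Y|.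

(* maximum average degree: max over nonempty vertex subsets S of
   2|E(G[S])|/|S| (maximum over all subgraphs is attained at induced ones);
   0 for the empty graph. *)
Local Open Scope ring_scope.
Definition mad : rat :=
  \big[Num.max/0]_(S : {set T} | S != set0) ((2 * #|edges_in S|)%:R / #|S|%:R).

End Graph.

(* Main.v *)
Require Import Defs.
From mathcomp Require Import all_boot all_order all_algebra.
From mathcomp Require Import zify.
Set Implicit Arguments. Unset Strict Implicit. Unset Printing Implicit Defensive.

(** Call an edge set [D] reducible if it contains edge-disjoint triangles [S] and an edge set
    [X], [#|X| <= 2 * #|S|], meeting every triangle that shares an edge with [D]: deleting [D]
    then lowers [nu] by at least [#|S|] and [tau] by at most [2 * #|S|], so it suffices to find
    a reducible set in every graph with an edge and average degree below 25/4.

    Suppose there is none, and ignore isolated vertices. Every edge lies in a triangle. Taking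
    [S] to be the triangles on a vertex [v] and a matching of its neighbourhood graph [H], and
    [X] to be this matching and the edges from [v] to equally many vertices covering the rest of
    [H], one sees that degrees are at least 5, and that for a low vertex [v] (degree 5 or 6) the
    complement of [H] is a matching. Two adjacent low vertices therefore have almost the same,
    almost complete neighbourhoods, and the edges at them contain a reducible set: low vertices
    are independent. A vertex of degree 7 with four low neighbours would have the three others
    as a cover and a matching of size three in its neighbourhood graph, so it has at most three
    low neighbours; a vertex of degree 8 has at most seven, since a triangle contains at most one
    low vertex. If now every other vertex gives 1/4 to each of its low neighbours, all final
    charges are at least 25/4. The reducible sets in bounded configurations are found by
    kernel computation. *)

(** * Edges, triangles, packings and covers *)

Lemma set2_eqP (T : finType) (x y u v : T) :
  [set x; y] = [set u; v] -> (x = u /\ y = v) \/ (x = v /\ y = u).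
Proof.
move=> /setP eqS; move: (eqS x) (eqS y) (eqS u) (eqS v); rewrite !inE !eqxx ?orbT /=.
move=> /esym/orP[]/eqP-> /esym/orP[]/eqP->; rewrite ?eqxx ?orbb; try by [left|right].
- by move=> _ /eqP->; left.
- by move=> /eqP-> _; left.
Qed.

Section Basics.
Variables (T : finType) (e : rel T).
Hypothesis e_simple : simple_graph e.
Let e_sym : symmetric e := proj1 e_simple.
Let e_irr : irreflexive e := proj2 e_simple.

Lemma edgesP (E : {set T}) :
  reflect (exists x y, E = [set x; y] /\ e x y) (E \in edges e).
Proof.
rewrite inE; apply: (iffP existsP) => [[x /existsP[y /andP[/eqP-> exy]]]|[x [y [-> exy]]]].
  by exists x, y.
by exists x; apply/existsP; exists y; rewrite eqxx.
Qed.

Lemma mem_edges x y : ([set x; y] \in edges e) = e x y.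
Proof.
apply/edgesP/idP => [[u [v [/set2_eqP[][-> ->]]]]|exy]; rewrite 1?e_sym //.
by exists x, y.
Qed.

Lemma adj_neq x y : e x y -> x != y.
Proof. by apply: contraTneq => ->; rewrite e_irr. Qed.

Lemma mem_triangles x y z : e x y -> e x z -> e y z -> [set x; y; z] \in triangles e.
Proof.
move=> exy exz eyz; rewrite inE -setUA cardsU1 cards2 !inE negb_or.
rewrite !adj_neq //=; apply/forall_inP => u; rewrite !inE => Hu.
apply/forall_inP => v; rewrite !inE => Hv; apply/implyP.
by case/or3P: Hu => /eqP->; case/or3P: Hv => /eqP->; rewrite ?eqxx // 1?e_sym.
Qed.

Lemma triangles_adj X x y : X \in triangles e -> x \in X -> y \in X -> x != y -> e x y.
Proof.
rewrite inE => /andP[_ /forall_inP tri] xX yX.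
by move: (tri x xX) => /forall_inP/(_ y yX)/implyP.
Qed.

Lemma card_triangles X : X \in triangles e -> #|X| = 3.
Proof. by rewrite inE => /andP[/eqP]. Qed.

(** The three edges are listed in the order of [pairs_of], so that this applies directly to indexed
    triples. *)
Lemma mem_tri_edges x y z (E : {set T}) : e x y -> e x z -> e y z ->
  (E \in tri_edges e [set x; y; z]) = (E \in [:: [set y; z]; [set x; y]; [set x; z]]).
Proof.
move=> exy exz eyz; rewrite [LHS]in_set !in_cons in_nil orbF; apply/andP/idP => [[]|].
  case/edgesP=> [u [v [-> euv]]].
  rewrite subUset !sub1set !inE -!orbA => /andP[].
  have nuv := adj_neq euv.
  do 2![case/or3P=> /eqP?]; subst; rewrite ?eqxx ?orbT // in nuv *;
  by rewrite ?(setUC [set z] [set x]) ?(setUC [set z] [set y]) ?(setUC [set y] [set x]) eqxx ?orbT.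
case/or3P=> /eqP->; rewrite mem_edges; split=> //; apply/subsetP=> w;
by rewrite !inE => /orP[]->; rewrite ?orbT.
Qed.

Lemma tri_edges_sub X : tri_edges e X \subset edges e.
Proof. by apply/subsetP => E; rewrite inE => /andP[]. Qed.

Lemma triangle_has_edge X : X \in triangles e -> exists E, E \in tri_edges e X.
Proof.
move=> triX; have /card_gt1P[x [y [xX yX nxy]]] : 1 < #|X| by rewrite card_triangles.
exists [set x; y]; rewrite in_set mem_edges (triangles_adj triX) //=.
by rewrite subUset !sub1set xX.
Qed.

Lemma tri_coverP (Y : {set {set T}}) : reflect (Y \subset edges e /\
   forall X, X \in triangles e -> exists2 E, E \in tri_edges e X & E \in Y) (tri_cover e Y).
Proof.
apply: (iffP andP) => -[sY H]; split => //.
  move=> X triX; have /forall_inP/(_ X triX) := H.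
  by rewrite disjoint_subset => /subsetPn[E EX]; rewrite inE negbK; exists E.
apply/forall_inP=> X triX; have [E EX EY] := H X triX.
by rewrite disjoint_subset; apply/subsetPn; exists E; rewrite // inE negbK.
Qed.

Lemma tri_packingP (P : {set {set T}}) : reflect (P \subset triangles e /\
   forall X Y E, X \in P -> Y \in P -> E \in tri_edges e X -> E \in tri_edges e Y -> X = Y)
  (tri_packing e P).
Proof.
apply: (iffP andP) => -[sP H]; split => //.
  move=> X Y E XP YP EX EY; apply: contraTeq H => nXY.
  apply/forall_inPn; exists X => //; apply/forall_inPn; exists Y => //.
  by rewrite nXY /=; apply/pred0Pn; exists E; rewrite /= EX.
apply/forall_inP=> X XP; apply/forall_inP=> Y YP; apply/implyP; apply: contraNT.
by case/pred0Pn => E /= /andP[EX EY]; apply/eqP/(H X Y E).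
Qed.

Lemma edges_cover : tri_cover e (edges e).
Proof.
apply/tri_coverP; split=> // X /triangle_has_edge[E EX]; exists E => //.
exact: (subsetP (tri_edges_sub X)).
Qed.

Lemma tau_le (Y : {set {set T}}) : tri_cover e Y -> tau e <= #|Y|.
Proof.
move=> covY; rewrite /tau; elim: (index_enum _) (mem_index_enum Y) => // A r IHr.
rewrite inE big_cons => /predU1P[<-|/IHr le]; first by rewrite covY geq_minl.
by case: ifP => // _; rewrite geq_min le orbT.
Qed.

Lemma tau_attained : exists2 Y, tri_cover e Y & #|Y| = tau e.
Proof.
rewrite /tau; apply: (big_ind (fun m => exists2 Y, tri_cover e Y & #|Y| = m)).
(* The default value of the minimum is attained too, by the cover consisting of all edges. *)
- by exists (edges e) => //; exact: edges_cover.
- by move=> a b [A covA <-] [B covB <-]; case: leqP => _; [exists A|exists B].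
- by move=> Y covY; exists Y.
Qed.

Lemma nu_ge (P : {set {set T}}) : tri_packing e P -> #|P| <= nu e.
Proof. by move=> packP; rewrite /nu (bigmax_sup P). Qed.

Lemma nu_attained : exists2 P, tri_packing e P & #|P| = nu e.
Proof.
rewrite /nu; apply: (big_ind (fun m => exists2 P, tri_packing e P & #|P| = m)).
- exists set0; last by rewrite cards0.
  by apply/tri_packingP; split=> [|X Y E]; rewrite ?sub0set // inE.
- by move=> a b [A packA <-] [B packB <-]; case: leqP => _; [exists B|exists A].
- by move=> P packP; exists P.
Qed.

(** An empty [S] is allowed, so an edge in no triangle is reducible by itself; [D != set0] makes the
    number of edges drop. *)
Definition reducible := exists D S X : {set {set T}},
  [/\ D != set0 /\ D \subset edges e, X \subset D,
      tri_packing e S /\ (forall t, t \in S -> tri_edges e t \subset D),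
      forall t, t \in triangles e -> ~~ [disjoint tri_edges e t & D] ->
        exists2 E, E \in tri_edges e t & E \in X
    & #|X| <= 2 * #|S|].

End Basics.

(** * Deleting a reducible set *)

Section Deletion.
Variables (T : finType) (e : rel T).
Hypothesis e_simple : simple_graph e.
Variable D : {set {set T}}.

Definition delete : rel T := fun x y => e x y && ([set x; y] \notin D).

Lemma delete_simple : simple_graph delete.
Proof.
case: e_simple => sym irr; split=> [x y|x]; rewrite /delete.
  by rewrite sym (setUC [set x]).
by rewrite irr.
Qed.

Lemma edges_delete : edges delete = edges e :\: D.
Proof.
apply/setP=> E; rewrite [RHS]inE; apply/edgesP/andP => [[x [y [-> /andP[exy nD]]]]|].
  by rewrite mem_edges.
by case=> nD /edgesP[x [y [eE exy]]]; exists x, y; rewrite /delete exy -eE nD.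
Qed.

Lemma tri_edges_delete X : tri_edges delete X = tri_edges e X :\: D.
Proof. by apply/setP=> E; rewrite [LHS]in_set edges_delete !in_setD [in RHS]in_set andbA. Qed.

Lemma triangles_delete X :
  (X \in triangles delete) = (X \in triangles e) && [disjoint tri_edges e X & D].
Proof.
apply/idP/andP => [triX|[triX disX]]; last first.
  have c3 := card_triangles triX.
  rewrite inE c3 eqxx; apply/forall_inP=> x xX; apply/forall_inP=> y yX; apply/implyP=> nxy.
  rewrite /delete (triangles_adj triX) //=; apply/negbT/(disjointFr disX).
  by rewrite in_set mem_edges // (triangles_adj triX) //= subUset !sub1set xX.
have adj x y : x \in X -> y \in X -> x != y -> delete x y := triangles_adj triX.
split.
  rewrite inE (card_triangles triX) eqxx; apply/forall_inP=> x xX; apply/forall_inP=> y yX.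
  by apply/implyP=> nxy; have /andP[] := adj x y xX yX nxy.
rewrite disjoint_subset; apply/subsetP=> E; rewrite inE => /andP[/edgesP[x [y [-> exy]]]].
rewrite subUset !sub1set => /andP[xX yX]; have /andP[] := adj x y xX yX (adj_neq e_simple exy).
by rewrite inE.
Qed.

End Deletion.

(** Triangles avoiding [D] survive the deletion and are met by an optimal cover of the smaller
    graph; the others are met by [X]. Triangles of a packing of the smaller graph have no edge in
    [D], those of [S] have all edges there, so the union is again a packing. *)
Lemma tuza_of_reducible (T : finType) (e : rel T) : simple_graph e -> reducible e ->
  exists e' : rel T, [/\ simple_graph e', subrel e' e, #|edges e'| < #|edges e|
    & tau e' <= 2 * nu e' -> tau e <= 2 * nu e].
Proof.
move=> se [D [S [X [[D0 sD] sXD [packS sSD] covX leXS]]]].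
exists (delete e D); split.
- exact: delete_simple.
- by move=> x y /andP[].
- rewrite edges_delete // cardsD; case/set0Pn: D0 => E ED.
  rewrite ltn_subrL !card_gt0; apply/andP; split; apply/set0Pn; exists E;
  by rewrite ?in_setI ?ED ?(subsetP sD).
have sd := delete_simple se D.
have [Y /tri_coverP[sY covY] <-] := tau_attained sd.
have [P /tri_packingP[sP packP] <-] := nu_attained (delete e D).
move=> leYP; have /tri_packingP[sS packS'] := packS.
apply: (@leq_trans #|Y :|: X|).
  apply: tau_le => //; apply/tri_coverP; split.
    rewrite subUset (subset_trans sXD) // andbT (subset_trans sY) //.
    by rewrite edges_delete // subsetDl.
  move=> t tri_t; have [dis|] := boolP [disjoint tri_edges e t & D]; last first.
    by case/(covX t tri_t) => E Et EX; exists E; rewrite // inE EX orbT.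
  have [|E] := covY t; first by rewrite triangles_delete // tri_t.
  by rewrite tri_edges_delete // in_setD => /andP[_ Et] EY; exists E; rewrite // inE EY.
apply: leq_trans (leq_card_setU _ _) _.
apply: leq_trans (leq_add leYP leXS) _; rewrite -mulnDr leq_mul2l /=.
have PD t : t \in P -> (t \in triangles e) && [disjoint tri_edges e t & D].
  by move=> tP; rewrite -triangles_delete // (subsetP sP).
have clash t t' E : t \in P -> t' \in S -> E \in tri_edges e t -> E \in tri_edges e t' -> False.
  move=> /PD/andP[_ dis] /sSD/subsetP/(_ E) sub Et /sub ED.
  by rewrite (disjointFr dis Et) in ED.
have disPS : [disjoint P & S].
  rewrite disjoint_subset; apply/subsetP=> t tP; rewrite inE; apply/negP=> tS.
  have /andP[/(triangle_has_edge se)[E Et] _] := PD t tP.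
  exact: (clash t t E).
have -> : #|P| + #|S| = #|P :|: S|.
  by rewrite -cardsUI (disjoint_setI0 disPS) cards0 addn0.
apply: nu_ge; apply/tri_packingP; split.
  rewrite subUset sS andbT; apply/subsetP=> t /PD/andP[] //.
move=> t t' E; rewrite !in_setU => /orP[tP|tS] /orP[t'P|t'S] Et Et'.
- have /andP[_ dis] := PD t tP; have /andP[_ dis'] := PD t' t'P.
  apply: (packP t t' E); rewrite // tri_edges_delete // in_setD.
    by rewrite (disjointFr dis Et).
  by rewrite (disjointFr dis' Et').
- by case: (clash t t' E).
- by case: (clash t' t E).
- exact: packS' Et Et'.
Qed.

(** * Templates, certificates and the decision procedure *)

Local Notation "b &&! c" := (if b then c else false) (at level 40, left associativity).

(* The virtual machine evaluates the arguments of [andb] and [orb] eagerly; [if] is lazy. *)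
Fixpoint lazy_all (A : Type) (p : pred A) (s : seq A) : bool :=
  if s is x :: s' then p x &&! lazy_all p s' else true.
Fixpoint lazy_has (A : Type) (p : pred A) (s : seq A) : bool :=
  if s is x :: s' then if p x then true else lazy_has p s' else false.

Lemma lazy_allE (A : Type) (p : pred A) s : lazy_all p s = all p s.
Proof. by elim: s => //= x s ->. Qed.

Lemma lazy_hasE (A : Type) (p : pred A) s : lazy_has p s = has p s.
Proof. by elim: s => //= x s ->. Qed.

(* Partial knowledge of a graph on [0 .. n - 1]: the entry at [i < j] tells whether [ij] is an
   edge, a non-edge, or unknown; the entries at [i >= j] are meaningless. *)
Definition template := seq (seq (option bool)).
Definition entry (tm : template) i j := nth None (nth [::] tm i) j.
Definition tabulate n (g : nat -> nat -> option bool) : template :=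
  mkseq (fun i => mkseq (g i) n) n.
Definition present (tm : template) (p : nat * nat) :=
  if entry tm p.1 p.2 is Some true then true else false.
Definition absent (tm : template) (p : nat * nat) :=
  if entry tm p.1 p.2 is Some false then true else false.
Definition set_pair (tm : template) (p : nat * nat) (b : bool) : template :=
  set_nth [::] tm p.1 (set_nth None (nth [::] tm p.1) p.2 (Some b)).

Definition triple := (nat * nat * nat)%type.
Definition pairs_of (t : triple) := [:: (t.1.2, t.2); (t.1.1, t.1.2); (t.1.1, t.2)].

(** Increasing triples give each edge a unique index pair, so [uniq] expresses edge-disjointness; a
    nonempty [ts] makes the deleted set nonempty. *)
Definition packs n (tm : template) (ts : seq triple) : bool :=
  lazy_all (fun t => lazy_all (present tm) (pairs_of t)) ts &&!
  all (fun t => (t.1.1 < t.1.2) && (t.1.2 < t.2 < n)) ts &&!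
  (ts != [::]) &&! uniq (flatten (map pairs_of ts)).

(* The triangles that must be met are those with a vertex below [r]; the edges deleted are
   those at such vertices and those of [xs], hence the last condition. *)
Definition covers n r (tm : template) (ts : seq triple) (xs : seq (nat * nat)) : bool :=
  lazy_all (fun i => lazy_all (fun j => lazy_all (fun k =>
      if lazy_has (absent tm) (pairs_of (i, j, k)) then true
      else has (mem xs) (pairs_of (i, j, k)))
    (iota j.+1 (n - j.+1))) (iota i.+1 (n - i.+1))) (iota 0 r) &&!
  (size xs <= 2 * size ts) &&!
  all (fun p => p.1 < p.2 < n) xs &&!
  all (fun p => (p.1 < r) || (p \in xs)) (flatten (map pairs_of ts)).

(* Triangles [S], with alternative choices of [X]. *)
Definition certificate := (seq triple * seq (seq (nat * nat)))%type.

Definition certifies n r tm (c : certificate) :=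
  packs n tm c.1 &&! lazy_has (covers n r tm c.1) c.2.

(* Decides the unknown pairs in [free] one by one until the template satisfies [bad], which
   describes what is excluded for other reasons, or admits a certificate from [cs]. *)
Fixpoint decide n r (bad : pred template) (cs : seq certificate) (free : seq (nat * nat)) tm :=
  if bad tm then true else if lazy_has (certifies n r tm) cs then true else
  if free is p :: free' then
    if entry tm p.1 p.2 is Some _ then decide n r bad cs free' tm else
    decide n r bad cs free' (set_pair tm p true) &&!
    decide n r bad cs free' (set_pair tm p false)
  else false.

Lemma uniq_flatten_inj (A B : eqType) (g : A -> seq B) (s : seq A) x y z :
  uniq (flatten (map g s)) -> x \in s -> y \in s -> z \in g x -> z \in g y -> x = y.
Proof.
elim: s => //= a s IHs; rewrite cat_uniq => /and3P[_ /hasPn dis us].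
have no b : b \in s -> z \in g b -> z \in g a -> False.
  move=> bs zb za; have /dis/= : z \in flatten (map g s) by apply/flatten_mapP; exists b.
  by rewrite za.
rewrite !inE => /predU1P[->|xs] /predU1P[->|ys] zx zy //; last exact: IHs.
- by case: (no y).
- by case: (no x).
Qed.

Lemma uniq_flatten_uniq (A B : eqType) (g : A -> seq B) (s : seq A) :
  (forall x, g x != [::]) -> uniq (flatten (map g s)) -> uniq s.
Proof.
move=> g0; elim: s => //= a s IHs; rewrite cat_uniq => /and3P[_ /hasPn dis /IHs->].
rewrite andbT; apply/negP => sa; case ga: (g a) (g0 a) => [|z r] // _.
have /dis : z \in flatten (map g s) by apply/flatten_mapP; exists a; rewrite ?ga ?mem_head.
by rewrite ga mem_head.
Qed.

(** * Soundness of the certificates *)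

Section Soundness.
Variables (T : finType) (e : rel T) (x0 : T) (s : seq T) (n r : nat).
Hypotheses (e_simple : simple_graph e) (s_uniq : uniq s) (s_size : size s = n) (r_le_n : r <= n).
Local Notation f := (nth x0 s).
Hypothesis closed : forall i u, i < r -> e (f i) u -> u \in s.

Definition agrees (tm : template) :=
  forall i j, i < j < n -> if entry tm i j is Some b then e (f i) (f j) = b else true.

Lemma agrees_tabulate (g : nat -> nat -> option bool) :
  (forall i j, i < j < n -> if g i j is Some b then e (f i) (f j) = b else true) ->
  agrees (tabulate n g).
Proof.
move=> gE i j ij; have /andP[lt jn] := ij.
by rewrite /entry nth_mkseq ?nth_mkseq ?(ltn_trans lt) //; exact: gE.
Qed.

Let E (p : nat * nat) : {set T} := [set f p.1; f p.2].
Let F (t : triple) : {set T} := [set f t.1.1; f t.1.2; f t.2].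

Lemma index_edge_inj p q : p.1 < p.2 < n -> q.1 < q.2 < n -> E p = E q -> p = q.
Proof.
case: p q => [a b] [c d] /= /andP[ab bn] /andP[cd dn] /set2_eqP[] [/eqP + /eqP +];
have [an cn] := (ltn_trans ab bn, ltn_trans cd dn);
rewrite !nth_uniq ?s_size // => /eqP/= eqa /eqP/= eqb; first by rewrite eqa eqb.
by move: ab; rewrite eqa eqb ltnNge ltnW.
Qed.

Lemma certifies_reducible tm c : agrees tm -> certifies n r tm c -> reducible e.
Proof.
case: c => ts xss agr; rewrite /certifies; case: ifP => //= pk.
rewrite lazy_hasE => /hasP[xs _]; move: pk.
rewrite /packs !lazy_allE; do 3![case: ifP => //]; move=> /allP pres /allP incr ts0 uts.
rewrite /covers lazy_allE; do 3![case: ifP => //]; move=> /allP cov sz /allP xok /allP outer.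
have vpair t p : t \in ts -> p \in pairs_of t -> (p.1 < p.2 < n) && e (f p.1) (f p.2).
  move=> tts pt; have lt : p.1 < p.2 < n.
    move: (incr t tts) => /andP[l1 /andP[l2 l3]].
    have [l13 l2n] := (ltn_trans l1 l2, ltn_trans l2 l3).
    by move: pt; rewrite !inE => /or3P[]/eqP->/=; rewrite ?l1 ?l2 ?l3 ?l13 ?l2n.
  rewrite lt; have := pres t tts; rewrite lazy_allE => /allP/(_ p pt); rewrite /present.
  by have := agr _ _ lt; case: (entry _ _ _) => [[]|].
have adjs t : t \in ts -> [/\ e (f t.1.1) (f t.1.2), e (f t.1.1) (f t.2) & e (f t.1.2) (f t.2)].
  move=> tts; have in_pairs p : p \in pairs_of t -> e (f p.1) (f p.2).
    by case/(vpair t p tts)/andP.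
  by split; [apply: (in_pairs (t.1.1, t.1.2))|apply: (in_pairs (t.1.1, t.2))
            |apply: (in_pairs (t.1.2, t.2))]; rewrite !inE eqxx ?orbT.
have triE t A : t \in ts -> (A \in tri_edges e (F t)) = (A \in map E (pairs_of t)).
  by move=> /adjs[e1 e2 e3]; rewrite mem_tri_edges.
have Finj t t' A : t \in ts -> t' \in ts -> A \in tri_edges e (F t) ->
    A \in tri_edges e (F t') -> t = t'.
  move=> tts t'ts; rewrite !triE // => /mapP[p pt ->] /mapP[q qt' /index_edge_inj eqpq].
  have /andP[lp _] := vpair _ _ tts pt; have /andP[lq _] := vpair _ _ t'ts qt'.
  by apply: (uniq_flatten_inj uts tts t'ts pt); rewrite (eqpq lp lq).
have uF : uniq (map F ts).
  rewrite map_inj_in_uniq ?(uniq_flatten_uniq _ uts) // => t t' tts t'ts eqF.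
  apply: (Finj t t' (E (t.1.2, t.2))) => //; first by rewrite triE // mem_head.
  by rewrite -eqF triE // mem_head.
(* The pairs in [xs] may be non-edges of the graph, hence the intersection with [edges e]. *)
pose S := [set X in map F ts]; pose X := [set A in map E xs] :&: edges e.
pose D := X :|: [set A in edges e | has (fun i => f i \in A) (iota 0 r)].
have sD t p : t \in ts -> p \in pairs_of t -> E p \in D.
  move=> tts pt; have /andP[lp ep] := vpair t p tts pt.
  have EpE : E p \in edges e by rewrite mem_edges.
  have /outer/orP[pr|px] : p \in flatten (map pairs_of ts) by apply/flatten_mapP; exists t.
    rewrite in_setU [X in _ || X]in_set EpE; apply/orP; right; apply/hasP.
    by exists p.1; rewrite ?mem_iota // !inE eqxx.
  by rewrite !(in_setU, in_setI) EpE in_set map_f.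
exists D, S, X; split.
- split.
    case: ts ts0 sD {pres incr uts sz outer vpair adjs triE Finj uF S} => // t ts _ sD.
    apply/set0Pn; exists (E (t.1.2, t.2)); apply: (sD t); exact: mem_head.
  rewrite subUset subsetIr; apply/subsetP=> A; by rewrite in_set => /andP[].
- exact: subsetUl.
- split.
    apply/tri_packingP; split.
      apply/subsetP=> Y; rewrite in_set => /mapP[t /adjs[? ? ?] ->].
      by apply: mem_triangles.
    move=> Y Z A; rewrite [Y \in S]in_set [Z \in S]in_set.
    by move=> /mapP[t tts ->] /mapP[t' t'ts ->] At At'; rewrite (Finj t t' A).
  move=> Y; rewrite in_set => /mapP[t tts ->]; apply/subsetP => A.
  by rewrite triE // => /mapP[p pt ->]; apply: (sD t).
(* A triangle sharing an edge with [D] has an edge in [X] or a vertex of index below [r]. In the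
   second case [closed] puts all its vertices in [s]; sorting their indices as [a < b < c] gives
   [a < r], so [covers] has examined it. *)
- move=> Y triY /pred0Pn[A /andP[/= AY]]; rewrite in_setU => /orP[AX|]; first by exists A.
  rewrite in_set => /andP[_ /hasP[i]]; rewrite mem_iota /= => ir iA.
  have iY : f i \in Y by move: AY; rewrite in_set => /andP[_ /subsetP->].
  have Ys : {subset Y <= s}.
    move=> u uY; have [<-|ne] := eqVneq (f i) u; last first.
      by apply: (closed ir); apply: (triangles_adj triY).
    by rewrite mem_nth // s_size (leq_trans ir).
  pose I := [seq k <- iota 0 n | f k \in Y].
  have IE k : (k \in I) = (f k \in Y) && (k < n) by rewrite mem_filter mem_iota.
  have uI : uniq I by rewrite filter_uniq ?iota_uniq.
  have YE : Y = [set:: map f I].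
    apply/setP => u; rewrite in_set; apply/idP/mapP => [uY|[k + ->]]; last first.
      by rewrite IE => /andP[].
    by exists (index u s); rewrite ?IE nth_index ?Ys // uY -s_size index_mem Ys.
  have sI : size I = 3.
    rewrite -(card_triangles triY) YE cardsE (card_uniqP _) ?size_map // map_inj_in_uniq //.
    move=> k l; rewrite !IE => /andP[_ kn] /andP[_ ln] /eqP.
    by rewrite nth_uniq ?s_size // => /eqP.
  have : sorted ltn I by rewrite sorted_filter ?iota_ltn_sorted //; exact: ltn_trans.
  have iI : i \in I by rewrite IE iY (leq_trans ir).
  case: I sI IE uI YE iI => [|a [|b [|c []]]] // _ IE _ YE iI /and3P[/= ab bc _].
  have [aI bI cI] : [/\ (f a \in Y) && (a < n), (f b \in Y) && (b < n) & (f c \in Y) && (c < n)].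
    by rewrite -!IE !inE !eqxx !orbT.
  move: aI bI cI => /andP[aY an] /andP[bY bn] /andP[cY cn].
  have ar : a < r.
    by move: iI ir; rewrite !inE => /or3P[]/eqP-> //; apply: ltn_trans => //; exact: ltn_trans bc.
  have YF : Y = F (a, b, c) by rewrite YE; apply/setP=> u; rewrite !inE /= orbA.
  have adj k l : k < l < n -> f k \in Y -> f l \in Y -> e (f k) (f l).
    move=> /andP[kl ln] kY lY; apply: (triangles_adj triY) => //.
    by rewrite nth_uniq ?s_size ?(ltn_trans kl) // neq_ltn kl.
  have [eab eac ebc] : [/\ e (f a) (f b), e (f a) (f c) & e (f b) (f c)].
    by split; apply: adj; rewrite ?ab ?bc ?(ltn_trans ab bc).
  have pE p : p \in pairs_of (a, b, c) -> E p \in tri_edges e Y.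
    move=> pp; rewrite YF mem_tri_edges //.
    by move: pp; rewrite !inE => /or3P[]/eqP->; rewrite eqxx ?orbT.
  have pe p : p \in pairs_of (a, b, c) -> (p.1 < p.2 < n) && e (f p.1) (f p.2).
    by rewrite !inE => /or3P[]/eqP->; rewrite /= ?ab ?bc ?(ltn_trans ab bc) ?bn ?cn ?eab ?eac ?ebc.
  have := cov a; rewrite mem_iota => /(_ ar); rewrite lazy_allE => /allP/(_ b).
  rewrite mem_iota subnKC // ab => /(_ bn); rewrite lazy_allE => /allP/(_ c).
  rewrite mem_iota subnKC // bc => /(_ cn); rewrite lazy_hasE; case: ifP => [/hasP[p pp]|_].
    have /andP[lp ep] := pe p pp; rewrite /absent; have := agr _ _ lp.
    by case: (entry _ _ _) => [[]|] //; rewrite ep.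
  case/hasP => p pp px; exists (E p); first exact: pE.
  have := pE p pp; rewrite in_set => /andP[Ep _].
  by rewrite in_setI Ep in_set map_f.
- have -> : #|S| = size ts by rewrite cardsE -(size_map F) -(card_uniqP uF).
  apply: leq_trans sz.
  rewrite -(size_map E); apply: leq_trans (subset_leq_card (subsetIl _ _)) _.
  by rewrite cardsE card_size.
Qed.

(** At an unknown pair, the branch recording its true status in [e] still agrees with [e]. Following
    these branches leads to a certificate, as [bad] never holds on the way. *)
Lemma decide_reducible bad cs free tm :
  (forall tm, agrees tm -> bad tm = false) ->
  agrees tm -> decide n r bad cs free tm -> reducible e.
Proof.
move=> good; elim: free tm => [|p free IHfree] tm agr /=; rewrite (good tm agr) lazy_hasE;
case: ifP => [/hasP[c _ cert] _|_ //]; do ?exact: certifies_reducible cert.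
case E1: (entry tm p.1 p.2) => [b|]; first exact: IHfree.
case: ifP => // yes no.
have agr' : agrees (set_pair tm p (e (f p.1) (f p.2))).
  move=> i j ij; rewrite /entry /set_pair nth_set_nth /=; case: eqP => [eqi|_]; last exact: agr.
  rewrite nth_set_nth /=; case: eqP => [eqj|_]; first by rewrite eqi eqj.
  by rewrite -eqi; exact: agr.
by move: agr'; case: (e _ _) => /IHfree; apply.
Qed.

End Soundness.

(** * Templates and certificates of the bounded configurations *)

Definition pairs_from m n := [seq (i, j) | i <- iota m (n - m), j <- iota i.+1 (n - i.+1)].
Definition sort_pair i j := (minn i j, maxn i j).
Definition sort_triple (t : triple) : triple :=
  if sort leq [:: t.1.1; t.1.2; t.2] is [:: a; b; c] then (a, b, c) else t.

Fixpoint arrangements k (s : seq nat) : seq (seq nat) :=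
  if k is k'.+1 then flatten [seq map (cons x) (arrangements k' (seq.rem x s)) | x <- s]
  else [:: [::]].

(** Vertex [0] is the centre, [M] a matching of its neighbourhood graph, and each [Q] a candidate
    vertex cover of the edges outside [M]. *)
Definition star_certificate (M : seq (nat * nat)) (Qs : seq (seq nat)) : certificate :=
  let M' := [seq sort_pair p.1 p.2 | p <- M] in
  ([seq (0, p.1, p.2) | p <- M'], [seq M' ++ [seq (0, q) | q <- Q] | Q <- Qs]).

(** The call on [seq.rem y s'] is not structural; the length of [s] is enough fuel. *)
Fixpoint matchings fuel (s : seq nat) : seq (seq (nat * nat)) :=
  if (fuel, s) is (fuel'.+1, x :: s') then
    [seq (x, y) :: M | y <- s', M <- matchings fuel' (seq.rem y s')] ++ matchings fuel' s'
  else [:: [::]].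

Fixpoint draws k (s : seq nat) : seq (seq nat) :=
  if k is k'.+1 then
    if s is x :: s' then map (cons x) (draws k' s') ++ draws k s' else [::]
  else [:: [::]].

Definition small_star_certificates d : seq certificate :=
  [seq star_certificate M (draws (size M) (iota 1 d)) | M <- matchings d (iota 1 d)].

(* The thirteen (matching, vertex cover) pairs were found by a greedy search over all graphs
   on [1 .. 6] in which 1 is adjacent to neither 2 nor 3; the permutations [s] preserve this
   condition. The full list of [small_star_certificates 6] would be needlessly slow. *)
Definition six_star_certificates : seq certificate :=
  undup [seq let g := nth 0 (0 :: 1 :: s) in
       star_certificate [seq (g p.1, g p.2) | p <- c.1] [:: map g c.2]
     | c <- [:: ([:: (1, 4); (2, 3); (5, 6)], [:: 4; 5; 6]);
                ([:: (1, 4); (2, 5); (3, 6)], [:: 4; 5; 6]);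
                ([:: (1, 4); (2, 3)], [:: 5; 6]);
                ([:: (2, 4); (3, 5)], [:: 4; 5]);
                ([:: (1, 4); (2, 5); (3, 6)], [:: 2; 4; 5]);
                ([:: (1, 4); (2, 5)], [:: 2; 4]);
                ([:: (1, 4); (5, 6)], [:: 2; 4]);
                ([:: (1, 4); (2, 3)], [:: 4; 5]);
                ([:: (1, 4); (2, 5); (3, 6)], [:: 1; 2; 3]);
                ([:: (1, 4); (2, 3)], [:: 1; 2]);
                ([:: (2, 3); (4, 5)], [:: 1; 2]);
                ([:: (1, 4)], [:: 4]);
                ([:: (1, 4); (2, 5)], [:: 5; 6])],
       s <- [seq t ++ u | t <- arrangements 2 [:: 2; 3], u <- arrangements 3 [:: 4; 5; 6]]].

(** Excluded because every edge at the centre lies in a triangle. *)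
Definition isolated d : pred template := fun tm =>
  lazy_has (fun i => lazy_all (fun j => if j == i then true else absent tm (sort_pair i j))
    (iota 1 d)) (iota 1 d).

Definition star_tm (i j : nat) : option bool := if i == 0 then Some true else None.
(** Two non-edges at the neighbour [1] of the centre: refuting this makes the complement of the
    neighbourhood graph a matching. *)
Definition cherry_tm (i j : nat) : option bool :=
  if i == 0 then Some true else
  if (i == 1) && ((j == 2) || (j == 3)) then Some false else None.

Lemma star_decided :
  all (fun d => decide d.+1 1 (isolated d) (small_star_certificates d) (pairs_from 1 d.+1)
                  (tabulate d.+1 star_tm)) (iota 1 4).
Proof. by vm_cast_no_check (erefl true). Qed.

Lemma cherry5_decided :
  decide 6 1 (isolated 5) (small_star_certificates 5) (pairs_from 1 6) (tabulate 6 cherry_tm).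
Proof. by vm_cast_no_check (erefl true). Qed.

Lemma cherry6_decided :
  decide 7 1 (isolated 6) six_star_certificates (pairs_from 1 7) (tabulate 7 cherry_tm).
Proof. by vm_cast_no_check (erefl true). Qed.

(* The adjacent low vertices are [v] and [w]; [x] is the neighbour of [v] alone (if [p]), [y]
   that of [w] alone (if [q]), and [A] enumerates the [k] common neighbours, ordered so that
   only [ab] and [cd] may be non-adjacent. *)
Definition twin_certificate (p q : bool) (k : nat) (A : seq nat) : certificate :=
  let v := 0 in let w := 1 in let x := 2 in let y := p + 2 in
  let a := nth 0 A 0 in let b := nth 0 A 1 in let c := nth 0 A 2 in
  let d := nth 0 A 3 in let z := nth 0 A 4 in
  let: (ts, xs) :=
    if k == 3 then
      ([:: (v,a,c); (v,x,b); (w,b,c); (w,y,a)],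
       [:: (v,w); (a,b); (a,c); (b,c); (x,b); (y,a); (v,x); (w,y)])
    else if p && q then
      ([:: (v,x,a); (v,b,c); (v,w,d); (w,y,b); (w,a,c)],
       [:: (v,w); (x,a); (y,b); (a,b); (a,c); (b,c); (v,d); (w,d); (v,x); (w,y)])
    else if k == 4 then
      ([:: (v,a,c); (v,b,d); (w,a,d); (w,b,c)],
       [:: (v,w); (a,b); (a,c); (a,d); (b,c); (b,d); (c,d)] ++ nseq p (v,x))
    else
      ([:: (v,w,z); (v,a,c); (v,b,d); (w,a,d); (w,b,c)],
       [:: (v,w); (v,z); (w,z); (a,b); (a,c); (a,d); (b,c); (b,d); (c,d)])
  in (map sort_triple ts, [:: [seq sort_pair p.1 p.2 | p <- xs]]).

(** [x] already misses [w] among the neighbours of [v], so it is adjacent to all common neighbours;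
    likewise [y]. Only the pair [xy] and the pairs inside [A] stay open. *)
Definition twin_tm (p q : bool) (i j : nat) : option bool :=
  if (i, j) == (0, 1) then Some true else
  if [&& p, q, i == 2 & j == 3] then None else
  if j < 2 + p then Some (i == 0) else
  if j < 2 + p + q then Some (i == 1) else
  if i < 2 + p + q then Some true else None.

(** Excluded because the complement of the neighbourhood graph of a low vertex is a matching. *)
Definition two_absent s : pred template := fun tm =>
  lazy_has (fun i => 1 < count (fun j => (j != i) && absent tm (sort_pair i j)) s) s.

(** The degrees of [v] and [w] are [k + p + 1] and [k + q + 1], each 5 or 6. With [q <= p] by
    symmetry, five cases remain. *)
Lemma twin_decided :
  all (fun t : bool * bool * nat => let: (p, q, k) := t in let m := 2 + p + q in
      decide (m + k) 2 (two_absent (iota m k))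
        (map (twin_certificate p q k) (arrangements k (iota m k)))
        (pairs_from m (m + k)) (tabulate (m + k) (twin_tm p q)))
    [:: (true, true, 3); (false, false, 4); (true, false, 4); (true, true, 4); (false, false, 5)].
Proof. by vm_cast_no_check (erefl true). Qed.

(** Vertices [1] to [4] are low neighbours of the centre [0], and [5] to [7] are its other
    neighbours. *)
Definition cone7_tm (i j : nat) : option bool :=
  if i == 0 then Some true else if j <= 4 then Some false else
  if i <= 4 then Some true else None.
Definition cone7_certificate : certificate :=
  ([:: (0,1,5); (0,2,6); (0,3,7)], [:: [:: (1,5); (2,6); (3,7); (0,5); (0,6); (0,7)]]).

Lemma cone7_certified : certifies 8 1 (tabulate 8 cone7_tm) cone7_certificate.
Proof. by vm_cast_no_check (erefl true). Qed.

(** * Local structure of irreducible graphs *)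

Section Irreducible.
Variables (T : finType) (e : rel T).
Hypotheses (e_simple : simple_graph e) (irreducible : ~ reducible e).
Let e_sym : symmetric e := proj1 e_simple.
Let e_irr : irreflexive e := proj2 e_simple.

Definition nbrs v := [set u | e v u].
Definition deg v := #|nbrs v|.
Definition low v := 0 < deg v <= 6.

(** Otherwise the edge alone is a reducible set, with no triangles and an empty cover. *)
Lemma edge_in_triangle x y : e x y -> exists2 z, e x z & e y z.
Proof.
move=> exy; case: (pickP (fun z => e x z && e y z)) => [z /andP[]|none]; first by exists z.
case: irreducible; exists [set [set x; y]], set0, set0; split.
- split; first by apply/set0Pn; exists [set x; y]; rewrite inE.
  by rewrite sub1set mem_edges.
- exact: sub0set.
- split=> [|t]; last by rewrite inE.
  by apply/tri_packingP; split=> [|X Y E]; rewrite ?sub0set // inE.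
- move=> t tri_t /pred0Pn[E /= /andP[+ /set1P eqE]]; rewrite {}eqE in_set => /andP[_].
  rewrite subUset !sub1set => /andP[xt yt].
  have nxy := adj_neq e_simple exy.
  have /set0Pn[z] : t :\ x :\ y != set0.
    rewrite -card_gt0; have := cardsD1 x t; have := cardsD1 y (t :\ x).
    by rewrite (card_triangles tri_t) xt !inE eq_sym nxy yt; lia.
  rewrite !inE => /and3P[zy zx zt]; have := none z.
  by rewrite !(triangles_adj tri_t) // eq_sym.
- by rewrite !cards0.
Qed.

Lemma star_irreducible v ns d tm cs free :
  uniq ns -> (forall u, (u \in ns) = e v u) -> size ns = d ->
  agrees e v (v :: ns) d.+1 tm -> ~ decide d.+1 1 (isolated d) cs free tm.
Proof.
move=> uns nsE sz agr dec; apply: irreducible.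
have uvns : uniq (v :: ns) by rewrite /= uns nsE e_irr.
apply: (decide_reducible e_simple uvns _ _ _ _ agr dec) => //=; first by rewrite sz.
  by case=> // u _ /= evu; rewrite inE nsE evu orbT.
move=> tm' agr'; apply/negbTE/negP; rewrite /isolated lazy_hasE => /hasP[i].
rewrite mem_iota add1n => /andP[i0 id]; rewrite lazy_allE => /allP abs.
pose u := nth v (v :: ns) i.
have eu : e v u by rewrite -nsE /u; case: i i0 id {abs u} => //= i _ id; rewrite mem_nth ?sz.
have [w ew uw] := edge_in_triangle eu.
have wns : w \in ns by rewrite nsE.
pose j := (index w ns).+1.
have jd : j <= d by rewrite /j -sz index_mem.
have wj : nth v (v :: ns) j = w by rewrite /= nth_index.
have nij : j != i by apply: contraTneq uw => eqij; rewrite /u -eqij wj e_irr.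
have := abs j; rewrite mem_iota add1n ltnS jd => /(_ isT); rewrite (negbTE nij).
have sij : (sort_pair i j).1 < (sort_pair i j).2 < d.+1 by rewrite /sort_pair /=; lia.
have := agr' _ _ sij; rewrite /absent; case: (entry _ _ _) => [[]|] //.
have -> : e (nth v (v :: ns) (sort_pair i j).1) (nth v (v :: ns) (sort_pair i j).2) = e u w.
  rewrite /sort_pair -wj /u; case: (leqP i j) => // _; exact: e_sym.
by rewrite uw.
Qed.

Lemma deg_ge5 v : 0 < deg v -> 4 < deg v.
Proof.
move=> d0; rewrite ltnNge; apply/negP => d4.
have := allP star_decided (deg v); rewrite mem_iota d0 add1n ltnS d4 => /(_ isT).
apply: (@star_irreducible v (enum (nbrs v))); rewrite ?enum_uniq // -?cardE //.
  by move=> u; rewrite mem_enum inE.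
apply: agrees_tabulate => -[|i] // [|j] //=; rewrite ltnS => jd.
have : nth v (enum (nbrs v)) j \in enum (nbrs v) by rewrite mem_nth // -cardE.
by rewrite mem_enum inE.
Qed.

(** Listing [x], [y], [z] first turns a counterexample into an instance of [cherry_tm], refuted by
    computation for the degrees 5 and 6. *)
Lemma low_nbrs v x y z : low v -> e v x -> e v y -> e v z ->
  x != y -> x != z -> y != z -> e x y || e x z.
Proof.
move=> /andP[d0 d6] vx vy vz xy xz yz; apply/negPn/negP; rewrite negb_or => /andP[nxy nxz].
pose rest := nbrs v :\ x :\ y :\ z; pose ns := [:: x, y, z & enum rest].
have uns : uniq ns.
  by rewrite /= !inE !mem_enum !inE !eqxx !negb_or xy xz yz !andbF enum_uniq.
have nsE u : (u \in ns) = e v u.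
  rewrite !in_cons mem_enum !inE.
  by case: eqVneq => [->|_] //=; case: eqVneq => [->|_] //=; case: eqVneq => [->|_] //=.
have sz : size ns = deg v.
  by rewrite -(card_uniqP uns); apply: eq_card => u; rewrite nsE inE.
have agr : agrees e v (v :: ns) (deg v).+1 (tabulate (deg v).+1 cherry_tm).
  apply: agrees_tabulate => -[|i] [|j] //.
    by rewrite ltnS -sz /= -nsE => jd; rewrite mem_nth.
  rewrite /cherry_tm /= !eqSS; case: i => //=; case: j => [|[|[|j]]] //= _; exact/negbTE.
have d5 := deg_ge5 d0; have := star_irreducible uns nsE sz agr.
have [->|->] : deg v = 5 \/ deg v = 6 by move: d5 d6; clear; lia.
  by apply; exact: cherry5_decided.
by apply; exact: cherry6_decided.
Qed.

Definition private v w := (nbrs v :\ w) :\: nbrs w.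

Lemma in_private v w u : (u \in private v w) = [&& ~~ e w u, u != w & e v u].
Proof. by rewrite !inE. Qed.

(** Among the neighbours of [v], the vertex [w] misses all private ones, and it can miss only
    one. *)
Lemma private_le1 v w : low v -> e v w -> #|private v w| <= 1.
Proof.
move=> low_v vw; apply/card_le1_eqP => x y; rewrite !in_private.
move=> /and3P[wx xw vx] /and3P[wy yw vy]; apply/eqP; apply: contraNT wx => xy.
by have := low_nbrs low_v vw vx vy; rewrite (negbTE wy) orbF; apply; rewrite 1?eq_sym.
Qed.

Lemma private_common v w x a : low v -> e v w -> x \in private v w -> e v a -> e w a -> e x a.
Proof.
move=> low_v vw; rewrite in_private => /and3P[wx xw vx] va wa.
have := low_nbrs low_v vx vw va; rewrite e_sym (negbTE wx) /=; apply=> //.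
  by apply: contraNneq wx => ->.
exact: adj_neq wa.
Qed.

Lemma deg_common v w : e v w -> deg v = #|nbrs v :&: nbrs w| + #|private v w| + 1.
Proof.
move=> vw; rewrite /deg (cardsD1 w) inE vw -(cardsID (nbrs w) (nbrs v :\ w)) addnC.
congr (_ + _ + _); apply: eq_card => u; rewrite !inE.
by case: eqVneq => [->|]; rewrite ?e_irr ?andbF.
Qed.

Lemma low_independent_wlog v w : low v -> low w -> e v w ->
  #|private w v| <= #|private v w| -> False.
Proof.
move=> low_v low_w vw; have wv : e w v by rewrite e_sym.
have [/andP[dv0 dv6] /andP[dw0 dw6]] := (low_v, low_w).
have := private_le1 low_v vw; have := private_le1 low_w wv.
have := deg_common vw; have := deg_common wv; rewrite [nbrs w :&: _]setIC.
have := deg_ge5 dv0; have := deg_ge5 dw0.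
have nvw := adj_neq e_simple vw.
set A := nbrs v :&: nbrs w.
have pP x : x \in enum (private v w) ->
    [/\ e v x, ~~ e w x, x != w & forall a, a \in enum A -> e x a].
  rewrite mem_enum => xP; have := xP; rewrite in_private => /and3P[wx xw vx]; split=> // a.
  rewrite mem_enum !inE => /andP[va wa]; exact: (private_common low_v vw xP).
have qP y : y \in enum (private w v) ->
    [/\ e w y, ~~ e v y, y != v & forall a, a \in enum A -> e y a].
  rewrite mem_enum => yP; have := yP; rewrite in_private => /and3P[vy yv wy]; split=> // a.
  rewrite mem_enum !inE => /andP[va wa]; exact: (private_common low_w wv yP).
have aP a : a \in enum A -> e v a /\ e w a by rewrite mem_enum !inE => /andP[].
pose s := [:: v, w & enum (private v w) ++ enum (private w v) ++ enum A].
have us : uniq s.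
  rewrite /s /= !cat_uniq !enum_uniq !inE !mem_cat !mem_enum !in_private !inE.
  rewrite (negbTE nvw) !e_irr !eqxx ?andbF /= !andbT.
  apply/andP; split; apply/hasPn => u.
    rewrite mem_cat => /orP[/qP[wu vu uv _]|/aP[vu wu]]; rewrite mem_enum in_private /=.
      by rewrite (negbTE vu) !andbF.
    by rewrite wu.
  by move/aP=> [vu wu]; rewrite mem_enum in_private /= vu.
have cl i u : i < 2 -> e (nth v s i) u -> u \in s.
  case: i => [|[|]] //= _ eu; rewrite !inE !mem_cat !mem_enum !in_private !inE eu.
    by case: (e w u); case: (u == w); rewrite ?orbT.
  by case: (e v u); case: (u == v); rewrite ?orbT.
rewrite !cardE.
move: pP qP us cl; rewrite {}/s.
move: (enum_uniq A).
have aA a b c : a \in enum A -> b \in enum A -> c \in enum A -> a != b -> a != c -> b != c ->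
    e a b || e a c.
  by move=> /aP[va _] /aP[vb _] /aP[vc _]; exact: low_nbrs low_v va vb vc.
move: (enum (private v w)) (enum (private w v)) (enum A) aP aA => ps qs As aP aA.
move=> uA pP qP us cl dw5 dv5 dw dv q1 p1 qp.
pose p := size ps == 1; pose q := size qs == 1; pose k := size As.
have [pE qE] : size ps = p /\ size qs = q by rewrite /p /q; move: p1 q1; clear; lia.
have n_eq : size [:: v, w & ps ++ qs ++ As] = 2 + p + q + k.
  by rewrite /= !size_cat pE qE -/k; clear; lia.
have nthA i : i < k -> nth v [:: v, w & ps ++ qs ++ As] (2 + p + q + i) = nth v As i.
  move=> _; have -> : 2 + p + q = size [:: v, w & ps ++ qs].
    by rewrite /= size_cat pE qE; clear; lia.
  by rewrite catA -!cat_cons nth_cat ltnNge leq_addr addKn.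
have agr : agrees e v [:: v, w & ps ++ qs ++ As] (2 + p + q + k)
    (tabulate (2 + p + q + k) (twin_tm p q)).
  apply: agrees_tabulate => i j; rewrite -{1}n_eq {n_eq nthA}.
  rewrite /twin_tm; case: (p) (q) pE qE => -[].
  - case: ps pP {us cl p1 qp dv p q} => [|x []] // /(_ x (mem_head _ _))[vx wx xw xA].
    case: qs qP {q1 dw} => [|y []] // /(_ y (mem_head _ _))[wy vy yv yA] _ _.
    case: i => [|[|[|[|i]]]]; case: j => [|[|[|[|j]]]] //= jA; rewrite ?(negbTE wx) ?(negbTE vy) //.
    + by have /aP[] : nth v As j \in As by rewrite mem_nth.
    + by have /aP[] : nth v As j \in As by rewrite mem_nth.
    + by apply: xA; rewrite mem_nth.
    + by apply: yA; rewrite mem_nth.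
  - case: ps pP {us cl p1 qp dv p q} => [|x []] // /(_ x (mem_head _ _))[vx wx xw xA].
    case: qs qP {q1 dw} => [|y []] // _ _ _.
    case: i => [|[|[|i]]]; case: j => [|[|[|j]]] //= jA; rewrite ?(negbTE wx) //.
    + by have /aP[] : nth v As j \in As by rewrite mem_nth.
    + by have /aP[] : nth v As j \in As by rewrite mem_nth.
    + by apply: xA; rewrite mem_nth.
  (* A private neighbour of [w] alone contradicts the assumed order of the two private counts. *)
  - by move: qp; rewrite /p /q; clear; lia.
  - case: ps {pP us cl p1 qp dv p q} => [|x []] // _.
    case: qs {qP q1 dw} => [|y []] // _.
    case: i => [|[|i]]; case: j => [|[|j]] //= jA //.
    + by have /aP[] : nth v As j \in As by rewrite mem_nth.
    + by have /aP[] : nth v As j \in As by rewrite mem_nth.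
apply: irreducible.
have bad tm : agrees e v [:: v, w & ps ++ qs ++ As] (2 + p + q + k) tm ->
    two_absent (iota (2 + p + q) k) tm = false.
  move=> agr'; apply/negbTE/negP; rewrite /two_absent lazy_hasE => /hasP[i].
  have inA j : j \in iota (2 + p + q) k ->
      exists2 j', j = 2 + p + q + j' & j' < k.
    by rewrite mem_iota; clear => /andP[le lt]; exists (j - (2 + p + q)); lia.
  move=> /inA[a -> ak]; rewrite -size_filter.
  set js := [seq _ <- _ | _]; have : uniq js by rewrite filter_uniq ?iota_uniq.
  have jsP j : j \in js ->
      exists b, [/\ j = 2 + p + q + b, b < k, b != a & ~~ e (nth v As a) (nth v As b)].
    rewrite mem_filter => /andP[/andP[nji abs] /inA[b eqj bk]]; exists b; split=> //.
      by move: nji; rewrite eqj; clear; lia.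
    have sij : (sort_pair (2 + p + q + a) j).1 < (sort_pair (2 + p + q + a) j).2 < 2 + p + q + k.
      by move: nji ak bk; rewrite /sort_pair /= eqj; clear; lia.
    have := agr' _ _ sij; move: abs; rewrite /absent; case: (entry _ _ _) => [[]|] // _.
    rewrite -!nthA // -eqj /sort_pair; case: (leqP (2 + p + q + a) j) => /= _; first by move=> ->.
    by rewrite e_sym => ->.
  case: js jsP => [|j1 [|j2 js]] // jsP /=; rewrite inE negb_or => /andP[/andP[nj _] _] _.
  have [b [eb bk ba nb]] := jsP j1 (mem_head _ _).
  have [|c [ec ck ca nc]] := jsP j2; first by rewrite !inE eqxx orbT.
  have := aA (nth v As a) (nth v As b) (nth v As c).
  rewrite !mem_nth // !nth_uniq // (negbTE nb) (negbTE nc) eq_sym ba eq_sym ca.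
  by move=> /(_ isT isT isT isT isT) H; apply: notF; apply: H; move: nj; rewrite eb ec; clear; lia.
have le2 : 2 <= 2 + p + q + k by rewrite -!addnA leq_addr.
have dec := allP twin_decided (p, q, k).
apply: (decide_reducible e_simple us n_eq le2 cl bad agr); apply: dec.
rewrite !inE !xpair_eqE; move: dw5 dv5 dw dv qp dv6 dw6; rewrite pE qE -/k.
by clear; case: (p); case: (q) => /=; lia.
Qed.

Lemma low_independent v w : low v -> low w -> ~~ e v w.
Proof.
move=> low_v low_w; apply/negP => vw.
have [|/ltnW] := leqP #|private w v| #|private v w|; first exact: low_independent_wlog.
by apply: low_independent_wlog; rewrite // e_sym.
Qed.

(** * Low neighbours and discharging *)

Lemma common_ge3 u v : low u -> e u v -> 2 < #|nbrs u :&: nbrs v|.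
Proof.
move=> low_u uv; have /andP[/deg_ge5 + _] := low_u.
have := private_le1 low_u uv; rewrite (deg_common uv); clear; lia.
Qed.

(** A low neighbour shares at least three neighbours with [v], none of them low. If four are low,
    only three other neighbours of [v] remain, so each of the four is adjacent to all three, as in
    [cone7_tm]. *)
Lemma low_nbrs_of_deg7 v : deg v = 7 -> #|[set u in nbrs v | low u]| <= 3.
Proof.
move=> dv; rewrite leqNgt; apply/negP => gt3.
set L := [set u in nbrs v | low u] in gt3.
pose us := take 4 (enum L).
have uus : uniq us by rewrite take_uniq ?enum_uniq.
have usP u : u \in us -> e v u /\ low u.
  by move=> /mem_take; rewrite mem_enum !inE => /andP[].
have szus : size us = 4 by rewrite size_takel // -cardE.
pose R := nbrs v :\: [set u in us].
have cR : #|R| = 3.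
  have cus : #|[set u in us]| = 4 by rewrite cardsE -szus; apply/card_uniqP.
  rewrite cardsDS ?cus; first by move: dv; rewrite /deg => ->.
  by apply/subsetP => u; rewrite in_set => /usP[vu _]; rewrite inE.
have usR u q : u \in us -> q \in enum R -> e u q.
  move=> uus' qR; have [vu low_u] := usP u uus'.
  have sub : nbrs u :&: nbrs v \subset R.
    apply/subsetP => w; rewrite !inE => /andP[uw vw]; rewrite vw andbT.
    by apply: contraTN uw => /usP[_ low_w]; exact: low_independent.
  have eqR : nbrs u :&: nbrs v = R.
    by apply/eqP; rewrite eqEcard sub cR common_ge3 // e_sym.
  by move: qR; rewrite mem_enum -eqR !inE => /andP[].
have usus u w : u \in us -> w \in us -> e u w = false.
  by move=> /usP[_ lu] /usP[_ lw]; apply/negbTE/low_independent.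
have RP q : q \in enum R -> e v q /\ q \notin us.
  by rewrite mem_enum !inE => /andP[-> ->].
have vRus u : e v u -> u \in us ++ enum R.
  by rewrite mem_cat mem_enum !inE => ->; rewrite andbT orbN.
have uv : uniq (v :: us ++ enum R).
  rewrite /= cat_uniq uus enum_uniq mem_cat andbT; apply/andP; split.
    by apply/negP => /orP[/usP[]|/RP[]]; rewrite e_irr.
  by apply/hasPn => q /RP[].
have sz : size (v :: us ++ enum R) = 8 by rewrite /= size_cat szus -cardE cR.
have cl i u : i < 1 -> e (nth v (v :: us ++ enum R) i) u -> u \in v :: us ++ enum R.
  by case: i => //= _ /vRus; rewrite inE => ->; rewrite orbT.
apply: irreducible.
apply: (certifies_reducible e_simple uv sz _ cl _ cone7_certified) => //.
apply: agrees_tabulate.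
have szR : size (enum R) = 3 by rewrite -cardE.
clear uus uv cl sz vRus.
move: (enum R) szR usR RP => qs szq usR RP.
have nthU i : i < 4 -> nth v (us ++ qs) i = nth v us i by move=> i4; rewrite nth_cat szus i4.
have nthR i : nth v (us ++ qs) (4 + i) = nth v qs i by rewrite nth_cat szus ltnNge leq_addr addKn.
have inU i : i < 4 -> nth v us i \in us by move=> ?; rewrite mem_nth // szus.
have inR i : i < 3 -> nth v qs i \in qs by move=> ?; rewrite mem_nth // szq.
move=> [|i] [|j] // /andP[+ j7] /=; rewrite ltnS in j7; rewrite ?ltnS => ij.
  have [j4|] := ltnP j 4; first by rewrite nthU //; case: (usP _ (inU j j4)).
  move=> /subnKC <-; rewrite nthR.
  have j3 : j - 4 < 3 by move: j7; clear; lia.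
  by case: (RP _ (inR _ j3)).
rewrite /cone7_tm /= !ltnS; have [j4|] := leqP j 3.
  by rewrite !nthU ?usus ?inU // (ltn_trans ij).
move=> j4; case: leqP => // i4.
rewrite -(subnKC j4) nthR nthU //; apply: usR; rewrite ?inU ?inR //.
by move: j7; clear; lia.
Qed.

(* Charges are multiplied by four. *)
Lemma discharging v : 0 < deg v ->
  25 + (if low v then 0 else #|[set u in nbrs v | low u]|)
    <= 4 * deg v + (if low v then deg v else 0).
Proof.
move=> d0; have d5 := deg_ge5 d0; case: ifP => low_v; first by move: d5; clear; lia.
have d7 : 6 < deg v by rewrite ltnNge; move: low_v; rewrite /low d0 => /= ->.
have le : #|[set u in nbrs v | low u]| <= deg v.
  by apply: subset_leq_card; apply/subsetP => u; rewrite !inE => /andP[].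
have [d7'|nd7] := eqVneq (deg v) 7.
  by have := low_nbrs_of_deg7 d7'; rewrite d7'; clear; lia.
(* From degree 9 on, [25 + d <= 4 * d] holds even if all neighbours are low. Degree 8 can afford
   exactly seven. *)
have [d8|nd8] := eqVneq (deg v) 8; last by move: d7 le nd7 nd8; clear; lia.
suff lt : #|[set u in nbrs v | low u]| < deg v by move: lt; rewrite d8; clear; lia.
apply: proper_card; rewrite properE; apply/andP; split.
  by apply/subsetP => u; rewrite !inE => /andP[].
apply/negP => /subsetP all_low; have lowP u : e v u -> low u.
  by move=> vu; have := all_low u; rewrite !inE vu /=; apply.
have /card_gt0P[u] := d0; rewrite inE => vu; have [w vw uw] := edge_in_triangle vu.
by have := low_independent (lowP u vu) (lowP w vw); rewrite uw.
Qed.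

(** Ordered adjacent pairs are grouped by their edge, at most two to a group. *)
Lemma handshake : \sum_v deg v <= 2 * #|edges e|.
Proof.
have -> : \sum_v deg v = \sum_(p : T * T | e p.1 p.2) 1.
  under eq_bigr => v _ do rewrite /deg -sum1_card.
  by rewrite pair_big_dep /=; apply: eq_bigl => p; rewrite inE.
rewrite (partition_big (fun p : T * T => [set p.1; p.2]) (mem (edges e))) /=; last first.
  by move=> p; rewrite mem_edges.
rewrite mulnC -sum_nat_const; apply: leq_sum => E /edgesP[x [y [-> _]]].
rewrite sum1_card; apply: (@leq_trans #|[set (x, y); (y, x)]|); last by rewrite cards2; case: eqP.
apply: subset_leq_card; apply/subsetP => -[u w]; rewrite !inE => /andP[_ /eqP /=].
by move=> /set2_eqP[][-> ->]; rewrite eqxx ?orbT.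
Qed.

Lemma irreducible_dense : 25 * #|[set v | 0 < deg v]| <= 8 * #|edges e|.
Proof.
set V := [set v | 0 < deg v].
pose g v := if low v then 0 else #|[set u in nbrs v | low u]|.
pose c v := if low v then deg v else 0.
(* Charge given equals charge received: both count the adjacent pairs with a low second vertex. A
   low vertex gives nothing, consistently with its having no low neighbour. *)
have gc : \sum_v g v = \sum_v c v.
  have -> : \sum_v c v = \sum_v \sum_(u | e v u && low v) 1.
    apply: eq_bigr => v _; rewrite /c; case: ifP => _; last first.
      by rewrite big_pred0 // => u; rewrite andbF.
    by rewrite /deg -sum1_card; apply: eq_bigl => u; rewrite inE andbT.
  rewrite (exchange_big_dep predT) //=; apply: eq_bigr => v _; rewrite /g.
  rewrite sum1_card; case: ifP => low_v.
    apply/esym/eq_card0 => u; rewrite inE /=; apply/negP => /andP[uv low_u].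
    by have := low_independent low_u low_v; rewrite uv.
  by apply: eq_card => u; rewrite !inE e_sym.
have out v : v \notin V -> g v = 0 /\ c v = 0 /\ deg v = 0.
  rewrite inE lt0n negbK => /eqP d0; rewrite /g /c /low d0; split=> //.
  apply/eqP; rewrite cards_eq0; apply/eqP/setP => u; rewrite !inE.
  apply/negP => /andP[vu _]; have : u \in nbrs v by rewrite inE.
  by rewrite (cards0_eq d0) inE.
have inV (h : T -> nat) : (forall v, v \notin V -> h v = 0) -> \sum_v h v = \sum_(v in V) h v.
  by move=> h0; rewrite (bigID (mem V)) /= [X in _ + X]big1 ?addn0.
have sum_le : \sum_(v in V) (25 + g v) <= \sum_(v in V) (4 * deg v + c v).
  by apply: leq_sum => v; rewrite inE; exact: discharging.
have d4 : \sum_(v in V) 4 * deg v = 4 * \sum_(v in V) deg v by rewrite big_distrr.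
move: sum_le; rewrite big_split /= [X in _ <= X]big_split /= sum_nat_const d4.
rewrite -inV => [|v /out[] //]; rewrite -inV => [|v /out[_ []] //].
rewrite -inV => [|v /out[_ []] //]; rewrite gc leq_add2r.
rewrite mulnC => /leq_trans; apply.
by rewrite (leq_trans (leq_mul (leqnn 4) handshake)) // mulnA.
Qed.

End Irreducible.

(** * Induction on the number of edges *)

Definition sparse (T : finType) (e : rel T) :=
  forall S : {set T}, S != set0 -> 8 * #|edges_in e S| < 25 * #|S|.

Lemma sparse_sub (T : finType) (e e' : rel T) : subrel e' e -> sparse e -> sparse e'.
Proof.
move=> sub sp S S0; apply: leq_ltn_trans (sp S S0); rewrite leq_mul2l /=.
apply: subset_leq_card; apply/subsetP => E; rewrite in_set => /andP[/edgesP[x [y [eqE exy]]] ES].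
by rewrite in_set ES andbT; apply/edgesP; exists x, y; split=> //; exact: sub.
Qed.

(** Sparsity is contradicted on the set of non-isolated vertices, which contains every edge. The
    double negation suffices for the decidable inequality in [tuza_sparse]. *)
Lemma sparse_reducible (T : finType) (e : rel T) :
  simple_graph e -> sparse e -> edges e != set0 -> ~ ~ reducible e.
Proof.
move=> se sp /set0Pn[E /edgesP[x [y [_ exy]]]] irr.
have xV : x \in [set v | 0 < deg e v].
  by rewrite inE; apply/card_gt0P; exists y; rewrite inE.
have V0 : [set v | 0 < deg e v] != set0 by apply/set0Pn; exists x.
have := sp _ V0; rewrite ltnNge => /negP; apply.
apply: leq_trans (irreducible_dense se irr) _; rewrite leq_mul2l /=.
apply: subset_leq_card; apply/subsetP => A EA; rewrite in_set EA.
have /edgesP[u [w [-> euw]]] := EA; rewrite subUset !sub1set /=.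
apply/andP; split; rewrite inE; apply/card_gt0P; [exists w | exists u];
by rewrite inE // (proj1 se).
Qed.

Lemma tuza_sparse (T : finType) (e : rel T) : simple_graph e -> sparse e -> tau e <= 2 * nu e.
Proof.
have [m] := ubnP #|edges e|; elim: m e => // m IHm e lem se sp.
have [e0|e0] := eqVneq (edges e) set0.
  by rewrite (leq_trans (tau_le (edges_cover se))) // e0 cards0.
rewrite leqNgt; apply/negP => big; apply: (sparse_reducible se sp e0) => red.
have [e' [se' sub lt lift]] := tuza_of_reducible se red.
move: big; rewrite ltnNge lift //; apply: IHm => //; first by exact: leq_trans lt _.
exact: sparse_sub sub sp.
Qed.

Import Order.TTheory GRing.Theory Num.Theory.

Lemma sparse_of_mad (T : finType) (e : rel T) : (mad e < 25%:R / 4%:R)%R -> sparse e.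
Proof.
move=> lt S S0.
have le : ((2 * #|edges_in e S|)%:R / #|S|%:R <= mad e)%R.
  exact: (le_bigmax_cond _ (fun S : {set T} => (2 * #|edges_in e S|)%:R / #|S|%:R)%R).
have S1 : 0 < #|S| by rewrite card_gt0.
have := le_lt_trans le lt.
rewrite ltr_pdivrMr ?ltr0n // mulrAC.
rewrite ltr_pdivlMr ?ltr0n // -!natrM ltr_nat.
by clear; lia.
Qed.

Theorem theorem6p1 (T : finType) (e : rel T) :
  simple_graph e -> (mad e < 25%:R / 4%:R)%R -> tau e <= 2 * nu e.
Proof. by move=> se /sparse_of_mad; exact: tuza_sparse. Qed.
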